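(* There is a universal constant $C>0$ such that the following holds. Let $\mu,\nu$ be probability measures on a measurable space $\mathcal X$ with $\nu\ll\mu$, let $\lambda=Z\cdot\frac{d\nu}{d\mu}$ with $Z>0$, and let $g:\mathcal X\to(0,\infty)$ be bounded and measurable, with $\nu_g=\mathbb E_\nu[g]$. For i.i.d. $X_1,\dots,X_n\sim\mu$ let $$\hat g_{\mathrm{SNIS}}=\frac{\sum_{i=1}^n\lambda(X_i)g(X_i)}{\sum_{i=1}^n\lambda(X_i)}.$$ Let $\epsilon,\delta\in(0,1)$ and let $M_{\epsilon,\delta}>0$ satisfy both $\mathrm{ICov}_{M_{\epsilon,\delta}}(g\nu\|\mu)\le\epsilon\delta M_{\epsilon,\delta}/6$ and $\mathrm{ICov}_{M_{\epsilon,\delta}}(\nu\|\mu)\le\epsilon\delta M_{\epsilon,\delta}/6$. If $n\ge C\,M_{\epsilon,\delta}/\epsilon$, then with probability at least $1-\delta$, $|\hat g_{\mathrm{SNIS}}-\nu_g|\le\epsilon\,\nu_g$.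
   Context: $g\nu$ denotes the probability measure with density $\frac{g(x)}{\nu_g}\cdot\frac{d\nu}{d\mu}(x)$ with respect to $\mu$. For probability measures $\rho\ll\mu$ with $r=\frac{d\rho}{d\mu}$, $\mathrm{Cov}_M(\rho\|\mu)=\rho(\{x:r(x)\ge M\})$ and $\mathrm{ICov}_M(\rho\|\mu)=\int_0^M\mathrm{Cov}_t(\rho\|\mu)\,dt$. *)

(* Defs.v *)
From HB Require Import structures.
From mathcomp Require Import all_boot all_order all_algebra.
From mathcomp Require Import all_classical all_reals all_analysis.
Set Implicit Arguments. Unset Strict Implicit. Unset Printing Implicit Defensive.
Import Order.TTheory GRing.Theory Num.Theory.
Local Open Scope classical_set_scope.
Local Open Scope ring_scope.
Local Open Scope ereal_scope.

Section defs.
Context {R : realType} {d : measure_display} {T : measurableType d}.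

Definition is_density (mu nu : {measure set T -> \bar R}) (r : T -> R) :=
  [/\ (forall x, (0 <= r x)%R), measurable_fun setT r &
      forall A, measurable A -> nu A = \int[mu]_(x in A) (r x)%:E].

(* Cov_M(rho || mu) = rho({x : r x >= M}), where rho = r . mu *)
Definition Cov (mu : {measure set T -> \bar R}) (r : T -> R) (M : R) : \bar R :=
  \int[mu]_(x in [set x | (M <= r x)%R]) (r x)%:E.

Definition ICov (mu : {measure set T -> \bar R}) (r : T -> R) (M : R) : \bar R :=
  \int[lebesgue_measure]_(t in `[0%R, M]) Cov mu r t.

Definition iid_law {dO : measure_display} {Omega : measurableType dO}
  (P : probability Omega R) (n : nat) (X : 'I_n -> Omega -> T)
  (mu : {measure set T -> \bar R}) :=
  (forall i, measurable_fun setT (X i)) /\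
  forall B : 'I_n -> set T, (forall i, measurable (B i)) ->
    P (\bigcap_(i in [set: 'I_n]) (X i @^-1` B i)) = \prod_(i < n) mu (B i).
End defs.

(* Main.v *)
Require Import Defs.
From HB Require Import structures.
From mathcomp Require Import all_boot all_order all_algebra.
From mathcomp Require Import all_classical all_reals all_analysis.
From mathcomp Require Import measurable_realfun ring lra.
Import Order.TTheory GRing.Theory Num.Theory.
Local Open Scope classical_set_scope.
Local Open Scope ring_scope.

(* The estimator is nu_g times the ratio of the empirical means of the two
   densities f = g r / nu_g and r, each of mu-mean 1. By Tonelli
   ICov_M(h) = E[h min(h, M)], which dominates both E[min(h, M)^2] and
   M E[h - min(h, M)]. So for h = f and h = r the truncation min(h, M) obeys
   Chebyshev's inequality (deviation eps/18, failure probability delta/6 as soon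
   as n >= 324 M / eps), while the tail h - min(h, M) obeys Markov's (deviation
   eps/2, failure probability delta/3). Outside an event of probability delta/2
   the empirical mean of h hence lies in [1 - 2 eps/9, 1 + 5 eps/9], and the
   ratio of two numbers of that interval is within eps of 1. *)

(** * Markov's inequality and change of density *)

Lemma ge0_markov {d : measure_display} {T : measurableType d} {R : realType}
    (P : {measure set T -> \bar R}) {Y : T -> R} {a : R} :
  measurable_fun setT Y -> (forall x, 0 <= Y x) -> 0 < a ->
  (a%:E * P [set x | (a <= Y x)%R] <= \int[P]_x (Y x)%:E)%E.
Proof.
move=> mY Y0 a0.
have -> : [set x | a <= Y x] = setT `&` [set x | (a%:E <= `|(Y x)%:E|)%E].
  by apply/seteqP; split => x /=; rewrite lee_fin ger0_norm ?Y0//; tauto.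
have -> : (\int[P]_x (Y x)%:E = \int[P]_x `|(Y x)%:E|)%E.
  by apply: eq_integral => x _ /=; rewrite ger0_norm.
by apply: le_integral_abse => //; exact/measurable_EFinP.
Qed.

(** The Radon-Nikodym derivative [p] and [r] integrate to [nu A] over every measurable [A], so they
    agree [mu]-almost everywhere; the change of variables known for [p] thus passes to [r]. *)
Lemma integral_density {d : measure_display} {T : measurableType d} {R : realType}
    (mu nu : probability T R) (r f : T -> R) :
  (nu `<< mu)%E -> is_density mu nu r ->
  measurable_fun setT f -> (forall x, 0 <= f x) ->
  (\int[nu]_x (f x)%:E = \int[mu]_x (f x * r x)%:E)%E.
Proof.
move=> numu [r0 mr rE] mf f0.
have mf' : measurable_fun setT (EFin \o f) by exact/measurable_EFinP.
have mr' : measurable_fun setT (EFin \o r) by exact/measurable_EFinP.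
pose p := Radon_Nikodym_SigmaFinite.f nu mu.
have pi : mu.-integrable setT p by exact: Radon_Nikodym_SigmaFinite.f_integrable.
have pr : ae_eq mu setT p (EFin \o r).
  apply: integral_ae_eq => // E _ mE.
  by rewrite -Radon_Nikodym_SigmaFinite.f_integral// rE.
rewrite -(Radon_Nikodym_SigmaFinite.change_of_variables numu)//.
apply: ae_eq_integral => //.
- by apply: emeasurable_funM => //; exact: measurable_int pi.
- exact/measurable_EFinP/measurable_funM.
- by apply: filterS pr => x /= /(_ I) e _; rewrite EFinM -e.
Qed.

(** * Integrated coverage as a truncated second moment *)

(** [ICov] is the iterated integral of [F], which equals [r x] where [0 <= t <= M] and [t <= r x],
    and 0 elsewhere. In the other order, the integral over [t] is [r x] times the length of the
    interval from 0 to [min (r x) M]. *)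
Lemma ICovE {d : measure_display} {T : measurableType d} {R : realType}
    (mu : probability T R) (r : T -> R) (M : R) :
  measurable_fun setT r -> (forall x, 0 <= r x) -> 0 < M ->
  ICov mu r M = (\int[mu]_x (r x * Num.min (r x) M)%:E)%E.
Proof.
move=> mr r0 M0.
pose F (z : R * T) :=
  (r z.2 * \1_(`[0, M] `*` setT) z * \1_[set z : R * T | z.1 <= r z.2] z)%:E.
have mr2 : measurable_fun setT (fun z : R * T => r z.2).
  exact: measurableT_comp.
have mS : measurable [set z : R * T | z.1 <= r z.2].
  by rewrite -[X in measurable X]setTI; exact: measurable_fun_le.
have mF : measurable_fun setT F.
  apply/measurable_EFinP; apply: measurable_funM; first apply: measurable_funM => //.
  - by apply: measurable_indic; exact: measurableX.
  - exact: measurable_indic.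
have F0 z : (0 <= F z)%E by rewrite lee_fin !mulr_ge0.
have FE t x : F (t, x) = if (0 <= t <= M) && (t <= r x) then (r x)%:E else 0%E.
  have e1 : ((t, x) \in `[0, M]%classic `*` [set: T]) = (0 <= t <= M).
    by apply/idP/idP; rewrite inE/= in_itv/=; [case|].
  have e2 : ((t, x) \in [set z : R * T | z.1 <= r z.2]) = (t <= r x).
    by apply/idP/idP; rewrite inE.
  rewrite /F !indicE e1 e2 /=.
  by case: (0 <= t <= M); case: (t <= r x); rewrite /= ?mulr1 ?mulr0 ?mul0r.
have -> : ICov mu r M = (\int[lebesgue_measure]_t \int[mu]_x F (t, x))%E.
  rewrite /ICov integral_mkcond; apply: eq_integral => t _.
  rewrite patchE; case: ifPn => tM.
    rewrite /Cov integral_mkcond; apply: eq_integral => x _.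
    rewrite patchE FE; move: tM; rewrite inE/= in_itv/= => ->/=.
    by case: ifPn; rewrite ?inE ?notin_setE/=; [move=> ->|move/negP/negbTE => ->].
  rewrite integral0_eq// => x _; rewrite FE.
  by move: tM; rewrite notin_setE/= in_itv/= => /negP/negbTE ->.
rewrite (@fubini_tonelli _ _ _ _ _ (@lebesgue_measure R) mu F)//; apply: eq_integral => x _.
pose m := Num.min (r x) M.
have m0 : 0 <= m by rewrite le_min r0 ltW.
transitivity (\int[lebesgue_measure]_(t in `[0%R, m]) (cst (r x)%:E t))%E.
  rewrite [RHS]integral_mkcond; apply: eq_integral => t _.
  rewrite patchE FE mem_setE in_itv/= le_min.
  by rewrite -andbA; congr (if _ then _ else _); rewrite (andbC (t <= M)).
rewrite integral_cst//= lebesgue_measure_itv/= lte_fin -/m.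
(* The length formula for an interval branches on [0 < m], so the degenerate interval [m = 0] is
   treated apart. *)
move: m0; rewrite le_eqVlt => /orP[/eqP<-|m0]; first by rewrite ltxx mule0 mulr0.
by rewrite m0 oppr0 adde0 EFinM.
Qed.

(** * First and second moments of i.i.d. sums *)

(** Taking every set but the [i]-th to be the whole space in [iid_law] shows that [X i] has law
    [mu]. *)
Lemma iid_integral1 {R : realType} {d dO : measure_display} {T : measurableType d}
    {Omega : measurableType dO} {P : probability Omega R} {n : nat}
    {X : 'I_n -> Omega -> T} {mu : probability T R} {h : T -> R} (i : 'I_n) :
  iid_law P X mu -> measurable_fun setT h -> (forall x, 0 <= h x) ->
  (\int[P]_w (h (X i w))%:E = \int[mu]_x (h x)%:E)%E.
Proof.
move=> [mX XE] mh h0.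
have mXi := mX i.
rewrite -[LHS](@ge0_integral_pushforward _ _ _ _ _ _ mXi P setT (EFin \o h))//=; last 2 first.
- exact/measurable_EFinP.
- by move=> x _; rewrite lee_fin.
apply: eq_measure_integral => A mA _ /=.
pose B k := if k == i then A else setT.
have := XE B; rewrite (bigD1 i)//= big1 ?mule1 => [|j ji]; last first.
  by rewrite /B (negbTE ji) probability_setT.
rewrite /B eqxx => <-; last by move=> k; case: ifP.
rewrite /pushforward; congr (P _); apply/seteqP; split => w /=.
  by move=> ? k _ /=; case: eqP => [->|].
by move/(_ i I); rewrite /= eqxx.
Qed.

(** By [iid_law], the law of the pair agrees with the product measure on rectangles, hence
    everywhere by uniqueness of the product measure. Tonelli then factors the integral, with no
    integrability to check since [h] is nonnegative. *)
Lemma iid_integral2 {R : realType} {d dO : measure_display} {T : measurableType d}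
    {Omega : measurableType dO} {P : probability Omega R} {n : nat}
    {X : 'I_n -> Omega -> T} {mu : probability T R} {h : T -> R} {i j : 'I_n} :
  iid_law P X mu -> measurable_fun setT h -> (forall x, 0 <= h x) -> i != j ->
  (\int[P]_w (h (X i w) * h (X j w))%:E =
   (\int[mu]_x (h x)%:E) * (\int[mu]_x (h x)%:E))%E.
Proof.
move=> [mX XE] mh h0 ij.
have mXij : measurable_fun setT (fun w => (X i w, X j w)).
  exact: measurable_fun_pair.
pose hh (z : T * T) := (h z.1 * h z.2)%:E.
have mhh : measurable_fun setT hh.
  by apply/measurable_EFinP/measurable_funM; exact: measurableT_comp.
rewrite -[LHS](@ge0_integral_pushforward _ _ _ _ _ _ mXij P setT hh)//=; last first.
  by move=> x _; rewrite lee_fin mulr_ge0.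
transitivity (\int[(mu \x mu)%E]_z hh z)%E.
  apply: eq_measure_integral => A mA _.
  apply/esym; apply: product_measure_unique => // {mA}A B mA mB.
  pose D k := if k == i then A else if k == j then B else setT.
  have := XE D; rewrite (bigD1 i)//= (bigD1 j) 1?eq_sym//= big1 ?mule1; last first.
    by move=> k /andP[ki kj]; rewrite /D (negbTE ki) (negbTE kj) probability_setT.
  rewrite /D eqxx eq_sym (negbTE ij) eqxx => <-; last by move=> k; do 2 case: ifP => //.
  rewrite /pushforward; congr (P _); apply/seteqP; split => w /=.
    move=> [? ?] k _ /=; case: eqP => [->//|_]; by case: eqP => [->|].
  by move=> H; split; [have /= := H i I|have /= := H j I]; rewrite ?eqxx// eq_sym (negbTE ij).
rewrite fubini_tonelli1//; last by move=> z; rewrite lee_fin mulr_ge0.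
have mh' : measurable_fun setT (EFin \o h) by exact/measurable_EFinP.
have I0 : (0 <= \int[mu]_x (h x)%:E)%E by apply: integral_ge0 => x _; rewrite lee_fin.
transitivity (\int[mu]_x ((\int[mu]_x (h x)%:E) * (h x)%:E))%E.
  apply: eq_integral => x _; rewrite /fubini_F muleC -ge0_integralZl//.
  - by move=> y _; rewrite lee_fin.
  - by rewrite lee_fin.
by rewrite ge0_integralZl// => x _; rewrite lee_fin.
Qed.

Lemma measurable_notin_itv {d : measure_display} {T : measurableType d} {R : realType}
    {Y : T -> R} (a b : R) :
  measurable_fun setT Y -> measurable [set w | ~ (a <= Y w <= b)].
Proof.
move=> mY.
rewrite (_ : [set _ | _] = ~` ([set w | a <= Y w] `&` [set w | Y w <= b])).
  apply: measurableC; apply: measurableI; rewrite -[X in measurable X]setTI;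
  exact: measurable_fun_le.
by apply/seteqP; split => w /= H; apply: contra_not H => /andP.
Qed.

Lemma iid_integral_sum {R : realType} {d dO : measure_display} {T : measurableType d}
    {Omega : measurableType dO} {P : probability Omega R} {n : nat}
    {X : 'I_n -> Omega -> T} {mu : probability T R} {h : T -> R} {c : R} :
  iid_law P X mu -> measurable_fun setT h -> (forall x, 0 <= h x) ->
  (\int[mu]_x (h x)%:E = c%:E)%E ->
  (\int[P]_w (\sum_(i < n) h (X i w))%R%:E = (n%:R * c)%:E)%E.
Proof.
move=> iid mh h0 hc; have [mX _] := iid.
under eq_integral do rewrite -sumEFin.
rewrite ge0_integral_sum//; last 2 first.
- by move=> i; apply/measurable_EFinP; exact: measurableT_comp.
- by move=> i w _; rewrite lee_fin.
under eq_bigr do rewrite (iid_integral1 _ iid)// hc.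
by rewrite sumEFin sumr_const card_ord mulr_natl.
Qed.

(** The variance of the sum is n times that of one term, which is at most the second moment. This is
    the input to Chebyshev's inequality. *)
Lemma iid_variance_le {R : realType} {d dO : measure_display} {T : measurableType d}
    {Omega : measurableType dO} {P : probability Omega R} {n : nat}
    {X : 'I_n -> Omega -> T} {mu : probability T R} {h : T -> R} {c s : R} :
  iid_law P X mu -> measurable_fun setT h -> (forall x, 0 <= h x) ->
  (\int[mu]_x (h x)%:E = c%:E)%E -> (\int[mu]_x (h x ^+ 2)%:E <= s%:E)%E ->
  (\int[P]_w ((\sum_(i < n) h (X i w) - n%:R * c) ^+ 2)%R%:E <= (n%:R * s)%:E)%E.
Proof.
move=> iid mh h0 hc hs; have [mX _] := iid.
have c0 : 0 <= c by rewrite -lee_fin -hc; apply: integral_ge0 => x _; rewrite lee_fin.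
have nc0 : 0 <= n%:R * c by rewrite mulr_ge0.
have mhX i : measurable_fun setT (fun w => h (X i w)) by exact: measurableT_comp.
pose S w := \sum_(i < n) h (X i w).
have mS : measurable_fun setT S by exact: measurable_sum.
have S0 w : 0 <= S w by apply: sumr_ge0.
(* the diagonal contributes n s, the off-diagonal pairs at most (n c)^2 *)
have ES2 : (\int[P]_w (S w ^+ 2)%:E <= (n%:R * s + (n%:R * c) ^+ 2)%:E)%E.
  have SE w : (S w ^+ 2)%:E = (\sum_(i < n) \sum_(j < n) (h (X i w) * h (X j w))%:E)%E.
    rewrite expr2 /S big_distrlr/= -sumEFin; apply: eq_bigr => i _.
    by rewrite -sumEFin.
  under eq_integral do rewrite SE.
  have mhh i j : measurable_fun setT (fun w => (h (X i w) * h (X j w))%:E).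
    by apply/measurable_EFinP; exact: measurable_funM.
  rewrite ge0_integral_sum//; last 2 first.
  - by move=> i; exact: emeasurable_sum.
  - by move=> i w _; apply: sume_ge0 => j _; rewrite lee_fin mulr_ge0.
  have -> : n%:R * s + (n%:R * c) ^+ 2 = \sum_(i < n) (s + \sum_(j < n) c ^+ 2).
    rewrite !sumr_const !card_ord -mulr_natl -[c ^+ 2 *+ n]mulr_natl; ring.
  rewrite -sumEFin; apply: lee_sum => i _.
  rewrite ge0_integral_sum//; last by move=> j w _; rewrite lee_fin mulr_ge0.
  rewrite EFinD -sumEFin (bigD1 i)//=; apply: leeD.
    apply: le_trans hs.
    rewrite -(iid_integral1 i iid (h := fun x => h x ^+ 2))//.
      exact: measurable_funX.
    by move=> x; exact: sqr_ge0.
  (* The sum on the right runs over all [j]; its diagonal term [c ^+ 2] is mere slack. *)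
  rewrite [leRHS](bigD1 i)//=; rewrite -[leLHS]add0e; apply: leeD.
    by rewrite lee_fin sqr_ge0.
  apply: lee_sum => j; rewrite eq_sym => ij.
  rewrite (iid_integral2 iid)//. by rewrite hc -EFinM expr2.
have ES : (\int[P]_w (S w)%:E = (n%:R * c)%:E)%E by exact: iid_integral_sum iid mh h0 hc.
have mV : measurable_fun setT (fun w => (S w - n%:R * c) ^+ 2).
  by apply: measurable_funX; exact: measurable_funB.
(* Both sides of (S - nc)^2 + 2 nc S = S^2 + (nc)^2 are sums of nonnegative
   functions, so they can be integrated in \bar R without integrability. *)
have E1 : (\int[P]_w (((S w - n%:R * c) ^+ 2)%:E + (2 * (n%:R * c))%:E * (S w)%:E) =
  \int[P]_w ((S w - n%:R * c) ^+ 2)%:E + (2 * (n%:R * c) * (n%:R * c))%:E)%E.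
  rewrite ge0_integralD//.
  - rewrite ge0_integralZl_EFin ?ES//.
    + by move=> w _; rewrite lee_fin.
    + exact/measurable_EFinP.
    + by rewrite mulr_ge0.
  - by move=> w _; rewrite lee_fin sqr_ge0.
  - exact/measurable_EFinP.
  - by move=> w _; rewrite -EFinM lee_fin !mulr_ge0.
  - by apply: measurable_funeM; exact/measurable_EFinP.
have E2 : (\int[P]_w (((S w - n%:R * c) ^+ 2)%:E + (2 * (n%:R * c))%:E * (S w)%:E) =
  \int[P]_w (S w ^+ 2)%:E + ((n%:R * c) ^+ 2)%:E)%E.
  transitivity (\int[P]_w ((S w ^+ 2)%:E + (cst ((n%:R * c) ^+ 2)%:E w)))%E.
    by apply: eq_integral => w _ /=; rewrite -EFinM -!EFinD; congr (_%:E); ring.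
  rewrite ge0_integralD//.
  - rewrite integral_cst// -[in RHS](mule1 (_ ^+ 2)%:E); congr (_ + _ * _)%E.
    exact: probability_setT.
  - by move=> w _; rewrite lee_fin sqr_ge0.
  - by apply/measurable_EFinP; exact: measurable_funX.
  - by move=> w _; rewrite lee_fin sqr_ge0.
have : (\int[P]_w ((S w - n%:R * c) ^+ 2)%:E + (2 * (n%:R * c) * (n%:R * c))%:E
  <= (n%:R * s + (n%:R * c) ^+ 2)%:E + ((n%:R * c) ^+ 2)%:E)%E.
  by rewrite -E1 E2 leeD2r.
(* Cancelling [2 (n c)^2] requires a finite integral; the bound just obtained excludes the value
   +oo. *)
rewrite -/(S _); case: (integral _ _ _) => [v| |]//=; last by move=> _; rewrite leNye.
by rewrite -!EFinD !lee_fin => ?; lra.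
Qed.

(** * Concentration of the empirical mean by truncation *)

(** The interval is asymmetric because the tail is nonnegative: below 1 only the bias and the
    fluctuation of the truncated part count, while above 1 the tail is added to that fluctuation. *)
Lemma iid_sum_concentration {R : realType} {d dO : measure_display} {T : measurableType d}
    {Omega : measurableType dO} {P : probability Omega R} {n : nat}
    {X : 'I_n -> Omega -> T} {mu : probability T R} {h : T -> R} {eps delta M : R} :
  iid_law P X mu -> measurable_fun setT h -> (forall x, 0 <= h x) ->
  (\int[mu]_x (h x)%:E = 1)%E -> 0 < eps -> 0 < delta < 1 -> 0 < M ->
  (ICov mu h M <= (eps * delta * M / 6)%:E)%E ->
  324 * M / eps <= n%:R ->
  (P [set w | ~ (n%:R * (1 - 2 / 9 * eps) <= \sum_(i < n) h (X i w)
                <= n%:R * (1 + 5 / 9 * eps))%R] <= (delta / 2)%:E)%E.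
Proof.
move=> iid mh h0 h1 e0 /andP[d0 d1] M0 + nM; rewrite ICovE// => hM.
have [mX _] := iid.
have n0 : 0 < n%:R :> R.
  by apply: lt_le_trans nM; rewrite divr_gt0 ?mulr_gt0.
pose u x := Num.min (h x) M; pose v x := h x - u x.
have u0 x : 0 <= u x by rewrite le_min h0 ltW.
have v0 x : 0 <= v x by rewrite subr_ge0 ge_min lexx.
have meas_u : measurable_fun setT u by exact: measurable_minr.
have mv : measurable_fun setT v by exact: measurable_funB.
have uvE : (\int[mu]_x (u x)%:E + \int[mu]_x (v x)%:E = 1)%E.
  rewrite -h1 -ge0_integralD//.
  - by apply: eq_integral => x _; rewrite -EFinD; congr (_%:E); rewrite addrC subrK.
  - by move=> x _; rewrite lee_fin.
  - exact/measurable_EFinP.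
  - by move=> x _; rewrite lee_fin.
  - exact/measurable_EFinP.
have Iu0 : (0 <= \int[mu]_x (u x)%:E)%E by apply: integral_ge0 => x _; rewrite lee_fin.
have Iv0 : (0 <= \int[mu]_x (v x)%:E)%E by apply: integral_ge0 => x _; rewrite lee_fin.
(* Two nonnegative extended reals with sum 1 are both finite. *)
have [a [b [ua vb ab]]] : exists a b : R, [/\ (\int[mu]_x (u x)%:E = a%:E)%E,
    (\int[mu]_x (v x)%:E = b%:E)%E & a + b = 1].
  move: uvE Iu0 Iv0; case: (integral _ _ _) => [a| |]; case: (integral _ _ _) => [b| |]//=.
  by move=> [ab] _ _; exists a, b.
have a0 : 0 <= a by rewrite -lee_fin -ua.
have b0 : 0 <= b by rewrite -lee_fin -vb.
have mum : measurable_fun setT (fun x => h x * u x) by exact: measurable_funM.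
(* Pointwise [M * v <= h * u]: the left side vanishes where [h <= M], and elsewhere [u = M] and
   [v = h - M <= h]. *)
have bM : M * b <= eps * delta * M / 6.
  rewrite -lee_fin EFinM -vb -ge0_integralZl_EFin//; last 3 first.
  - by move=> x _; rewrite lee_fin.
  - exact/measurable_EFinP.
  - exact: ltW.
  apply: le_trans hM; apply: ge0_le_integral => //.
  - by move=> x _; rewrite -EFinM lee_fin mulr_ge0//; exact: ltW.
  - by apply: measurable_funeM; exact/measurable_EFinP.
  - exact/measurable_EFinP.
  - move=> x _; rewrite -EFinM lee_fin /v /u; case: (leP (h x) M) => hxM.
      by rewrite subrr mulr0 mulr_ge0.
    by rewrite [leRHS]mulrC ler_pM2l//; lra.
have b6 : b <= eps * delta / 6.
  by move: bM; rewrite (_ : _ / 6 = M * (eps * delta / 6)) ?ler_pM2l//; ring.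
have su : (\int[mu]_x (u x ^+ 2)%:E <= (eps * delta * M / 6)%:E)%E.
  apply: le_trans hM; apply: ge0_le_integral => //.
  - by move=> x _; rewrite lee_fin sqr_ge0.
  - by apply/measurable_EFinP; exact: measurable_funX.
  - exact/measurable_EFinP.
  - by move=> x _; rewrite lee_fin expr2 ler_wpM2r// ge_min lexx.
have Ev := iid_integral_sum iid mv v0 vb.
have Vu := iid_variance_le iid meas_u u0 ua su.
pose U w := \sum_(i < n) u (X i w); pose V w := \sum_(i < n) v (X i w).
have mU : measurable_fun setT U.
  by apply: measurable_sum => i; exact: measurableT_comp.
have mV : measurable_fun setT V.
  by apply: measurable_sum => i; exact: measurableT_comp.
have V0 w : 0 <= V w by apply: sumr_ge0.
have mU2 : measurable_fun setT (fun w => (U w - n%:R * a) ^+ 2).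
  by apply: measurable_funX; exact: measurable_funB.
have hUV w : \sum_(i < n) h (X i w) = U w + V w.
  by rewrite -big_split/=; apply: eq_bigr => i _; rewrite addrC subrK.
pose A1 := [set w | n%:R * eps / 2 <= V w].
pose A2 := [set w | (n%:R * eps / 18) ^+ 2 <= (U w - n%:R * a) ^+ 2].
have mA1 : measurable A1.
  by rewrite -[X in measurable X]setTI; exact: measurable_fun_le.
have mA2 : measurable A2.
  by rewrite -[X in measurable X]setTI; exact: measurable_fun_le.
have ne2 : 0 < n%:R * eps / 2 by rewrite divr_gt0 ?mulr_gt0.
have ne18 : 0 < n%:R * eps / 18 by rewrite divr_gt0 ?mulr_gt0.
(* Markov: [n b / (n eps / 2)] is at most [(eps delta / 6) / (eps / 2) = delta / 3]. *)
have P1 : (P A1 <= (delta / 3)%:E)%E.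
  have : ((n%:R * eps / 2)%:E * P A1 <= (n%:R * b)%:E)%E.
    by rewrite -Ev; exact: ge0_markov.
  have -> : P A1 = (fine (P A1))%:E by rewrite fineK//; exact: fin_num_measure.
  rewrite -EFinM !lee_fin => H.
  rewrite -(ler_pM2l ne2); apply: le_trans H _.
  rewrite (_ : _ * (delta / 3) = n%:R * (eps * delta / 6)); last by field.
  by rewrite ler_pM2l.
(* Chebyshev gives [(delta / 6) * 324 M / (n eps)], where 324 is the square of 18; the lower bound
   on [n] makes the last factor at most 1. *)
have P2 : (P A2 <= (delta / 6)%:E)%E.
  have : (((n%:R * eps / 18) ^+ 2)%:E * P A2 <= (n%:R * (eps * delta * M / 6))%:E)%E.
    by apply: le_trans Vu; apply: ge0_markov; rewrite ?exprn_gt0// => w; exact: sqr_ge0.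
  have -> : P A2 = (fine (P A2))%:E by rewrite fineK//; exact: fin_num_measure.
  rewrite -EFinM !lee_fin => H.
  rewrite -(ler_pM2l (exprn_gt0 2 ne18)); apply: le_trans H _.
  rewrite (_ : _ * (delta / 6) = n%:R * (eps * delta / 6 * (n%:R * eps / 324))); last by field.
  rewrite ler_pM2l// (_ : _ * M / 6 = eps * delta / 6 * M); last by ring.
  rewrite ler_pM2l ?divr_gt0 ?mulr_gt0//.
  by move: nM; rewrite ler_pdivrMr// => ?; lra.
apply: (@le_trans _ _ (P (A1 `|` A2))).
  apply: le_measure; rewrite ?inE//; last 2 first.
  - exact: measurableU.
  - move=> w /= H; apply: contrapT => /not_orP[/negP + /negP].
    rewrite -!ltNge => V1 U1; apply: H; rewrite hUV.
    have n0' := ltW n0.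
    have : `|U w - n%:R * a| < n%:R * eps / 18.
      by rewrite -(ltr_pXn2r (n := 2)) ?nnegrE ?normr_ge0 ?ltW// real_normK ?num_real.
    rewrite ltr_norml => /andP[U2 U3].
    have Vw := V0 w.
    have na : n%:R * a = n%:R - n%:R * b by rewrite (_ : a = 1 - b) ?mulrBr ?mulr1//; lra.
    have nb : n%:R * b <= n%:R * eps / 6.
      rewrite -mulrA ler_pM2l//; apply: le_trans b6 _.
      by rewrite ler_pM2r// ger_pMr// ltW.
    have nb0 : 0 <= n%:R * b by rewrite mulr_ge0.
    (* Since [a = 1 - b] with [0 <= b <= eps / 6], the loss below is [1/6 + 1/18 = 2/9] of [eps] and
       the excess above is [1/18 + 1/2 = 5/9] of [eps]. *)
    by apply/andP; split; lra.
  apply: measurable_notin_itv; apply: measurable_sum => i.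
  exact: measurableT_comp.
apply: (@le_trans _ _ (P A1 + P A2)%E); first exact: measureU2.
apply: le_trans (leeD P1 P2) _.
by rewrite -EFinD lee_fin; lra.
Qed.

(** * The normalising constant and the accuracy of the estimator *)

(** The bound [K] gives finiteness. Were the integral 0, [g] would vanish almost everywhere; as [g]
    vanishes nowhere, the whole space would be null. *)
Lemma integral_gt0_bounded {d : measure_display} {T : measurableType d} {R : realType}
    (nu : probability T R) (g : T -> R) (K : R) :
  measurable_fun setT g -> (forall x, 0 < g x) -> (forall x, g x <= K) ->
  exists2 c : R, 0 < c & (\int[nu]_x (g x)%:E = c%:E)%E.
Proof.
move=> mg g0 gK.
have mg' : measurable_fun setT (EFin \o g) by exact/measurable_EFinP.
have nuT : nu setT = 1%E by exact: probability_setT.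
have I0 : (0 <= \int[nu]_x (g x)%:E)%E.
  by apply: integral_ge0 => x _; rewrite lee_fin ltW.
have IK : (\int[nu]_x (g x)%:E <= K%:E)%E.
  apply: (@le_trans _ _ (\int[nu]_x (cst K%:E x)))%E.
    apply: ge0_le_integral => //.
    - by move=> x _; rewrite lee_fin ltW.
    - by move=> x _; rewrite lee_fin.
  by rewrite integral_cst// [X in (_ * X)%E]nuT mule1.
have IE : (\int[nu]_x (g x)%:E = (fine (\int[nu]_x (g x)%:E))%:E)%E.
  rewrite fineK// fin_numE; apply/andP; split.
    by move: I0; case: (integral _ _ _).
  by move: IK; case: (integral _ _ _).
exists (fine (\int[nu]_x (g x)%:E)) => //.
rewrite lt_neqAle -lee_fin -IE I0 andbT; apply/eqP => z.
have : (\int[nu]_x `|(EFin \o g) x| = 0)%E.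
  under eq_integral do rewrite /= gtr0_norm//.
  by rewrite IE -z.
move/(ae_eq_integral_abs nu measurableT mg') => [N [mN N0 sN]].
have NT : N = setT.
  apply/seteqP; split => // x _; apply: sN => /= /(_ I) [] /eqP.
  by rewrite gt_eqF.
have : (1 = 0 :> \bar R)%E by rewrite -nuT -NT; exact: N0.
by move/eqP; rewrite onee_eq0.
Qed.

Theorem theorem15 :
  exists C : nat, (0 < C)%N /\
  forall (R : realType) (d : measure_display) (T : measurableType d)
    (mu nu : probability T R) (r : T -> R) (Z : R) (g : T -> R)
    (dO : measure_display) (Omega : measurableType dO) (P : probability Omega R)
    (n : nat) (X : 'I_n -> Omega -> T) (eps delta M : R),
  (nu `<< mu)%E ->
  is_density mu nu r ->
  0 < Z ->
  (forall x, 0 < g x) -> measurable_fun setT g -> (exists K : R, forall x, g x <= K) ->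
  iid_law P X mu ->
  0 < eps < 1 -> 0 < delta < 1 -> 0 < M ->
  let nu_g := fine (\int[nu]_x (g x)%:E) in
  let lam := fun x => Z * r x in
  (ICov mu (fun x => (g x / nu_g * r x)%R) M <= (eps * delta * M / 6)%:E)%E ->
  (ICov mu r M <= (eps * delta * M / 6)%:E)%E ->
  C%:R * M / eps <= n%:R ->
  let g_snis := fun w : Omega =>
    (\sum_(i < n) lam (X i w) * g (X i w)) / (\sum_(i < n) lam (X i w)) in
  ((1 - delta)%:E <= P [set w | (`|g_snis w - nu_g| <= eps * nu_g)%R])%E.
Proof.
exists 324%N; split => // R d T mu nu r Z g dO Omega P n X eps delta M.
move=> numu dens Z0 g0 mg [K gK] iid /andP[e0 e1] delta01 M0 nu_g lam.
have [r0 mr rE] := dens.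
have [mX _] := iid.
have [c c0 gc] := integral_gt0_bounded nu g K mg g0 gK.
have -> : nu_g = c by rewrite /nu_g gc.
pose f x := g x / c * r x.
rewrite -/f => hf hr nM.
set g_snis := fun w => _.
have mgc : measurable_fun setT (fun x => g x / c).
  by apply: measurable_funM => //; exact: measurable_cst.
have mf : measurable_fun setT f by exact: measurable_funM.
have gc0 x : 0 <= g x / c by rewrite divr_ge0// ltW.
have f0 x : 0 <= f x by rewrite mulr_ge0.
have f1 : (\int[mu]_x (f x)%:E = 1)%E.
  rewrite -(integral_density mu nu r (fun x => g x / c) numu dens)//.
  transitivity (\int[nu]_x ((c^-1)%:E * (g x)%:E))%E.
    by apply: eq_integral => x _; rewrite -EFinM mulrC.
  rewrite ge0_integralZl_EFin//.
  - by rewrite gc -EFinM mulVf// gt_eqF.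
  - by move=> x _; rewrite lee_fin ltW.
  - exact/measurable_EFinP.
  - by rewrite invr_ge0 ltW.
have r1 : (\int[mu]_x (r x)%:E = 1)%E.
  by rewrite -rE//; exact: probability_setT.
pose Sf w := \sum_(i < n) f (X i w); pose Sr w := \sum_(i < n) r (X i w).
have mSf : measurable_fun setT Sf.
  by apply: measurable_sum => i; exact: measurableT_comp.
have mSr : measurable_fun setT Sr.
  by apply: measurable_sum => i; exact: measurableT_comp.
have Sr0 w : 0 <= Sr w by apply: sumr_ge0.
(* The unknown factor [Z] cancels, and [r g = c f] brings out the target value [c]. *)
have snisE w : g_snis w = c * (Sf w / Sr w).
  rewrite /g_snis /lam /Sf /Sr.
  have -> : \sum_(i < n) Z * r (X i w) * g (X i w) = Z * c * \sum_(i < n) f (X i w).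
    rewrite mulr_sumr; apply: eq_bigr => i _; rewrite /f; field.
    by rewrite gt_eqF.
  by rewrite -mulr_sumr invfM mulrACA [Z * c]mulrC mulfK// gt_eqF.
(* Clearing the denominator leaves inequalities between sums, whose measurability is immediate. *)
pose E := [set w | 0 < Sr w] `&` [set w | `|Sf w - Sr w| <= eps * Sr w].
have EE : [set w | `|g_snis w - c| <= eps * c] = E.
  have rw w : `|g_snis w - c| = c * `|Sf w / Sr w - 1|.
    by rewrite snisE -[X in _ - X]mulr1 -mulrBr normrM gtr0_norm.
  apply/seteqP; split => w /=; rewrite /E /= rw [eps * c]mulrC ler_pM2l//.
    (* Division by 0 returns 0, so where [Sr w = 0] the relative error is 1, which exceeds [eps];
       such points lie outside both sets. *)
    have [->|Sn0] := eqVneq (Sr w) 0.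
      by rewrite invr0 mulr0 sub0r normrN normr1 leNgt e1.
    have Sp : 0 < Sr w by rewrite lt_neqAle eq_sym Sn0 Sr0.
    move=> H; split => //.
    have -> : Sf w - Sr w = (Sf w / Sr w - 1) * Sr w by field.
    by rewrite normrM (gtr0_norm Sp) ler_pM2r.
  move=> [Sp H]; rewrite -(ler_pM2r Sp) -[X in _ * X <= _](gtr0_norm Sp) -normrM.
  by rewrite mulrBl mul1r divfK// gt_eqF.
rewrite /= EE.
have mE : measurable E.
  apply: measurableI.
    rewrite (_ : [set w | 0 < Sr w] = ~` [set w | Sr w <= 0]).
      apply: measurableC; rewrite -[X in measurable X]setTI.
      exact: measurable_fun_le.
    by apply/seteqP; split => w /=; rewrite ltNge => /negP.
  rewrite -[X in measurable X]setTI; apply: measurable_fun_le => //.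
    by apply: measurableT_comp => //; exact: measurable_funB.
  exact: measurable_funM.
pose B (S : Omega -> R) :=
  [set w | ~ (n%:R * (1 - 2 / 9 * eps) <= S w <= n%:R * (1 + 5 / 9 * eps))].
have mB S : measurable_fun setT S -> measurable (B S) by exact: measurable_notin_itv.
have PBf : (P (B Sf) <= (delta / 2)%:E)%E.
  exact: iid_sum_concentration iid mf f0 f1 e0 delta01 M0 hf nM.
have PBr : (P (B Sr) <= (delta / 2)%:E)%E.
  exact: iid_sum_concentration iid mr r0 r1 e0 delta01 M0 hr nM.
have n0 : 0 < n%:R :> R.
  by apply: lt_le_trans nM; rewrite divr_gt0 ?mulr_gt0.
have PC : (P (~` E) <= delta%:E)%E.
  apply: (@le_trans _ _ (P (B Sf `|` B Sr))).
    apply: le_measure; rewrite ?inE.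
    - exact: measurableC.
    - by apply: measurableU; exact: mB.
    - move=> w; apply: contra_notP.
      move=> /not_orP[/contrapT/andP[f1w f2w] /contrapT/andP[r1w r2w]].
      have s1 : 0 < Sr w.
        by apply: lt_le_trans r1w; rewrite mulr_gt0//; lra.
      split => //=.
      (* Both sums lie in an interval of length [7/9 n eps], while [eps * Sr w] is at least
         [n eps (1 - 2/9 eps)], hence at least [7/9 n eps] because [eps < 1]. *)
      have q : 0 <= n%:R * eps by rewrite mulr_ge0 ?ltW.
      have q2 : n%:R * eps * eps <= n%:R * eps by rewrite ger_pMr ?mulr_gt0 ?ltW.
      have h1 : eps * (n%:R * (1 - 2 / 9 * eps)) <= eps * Sr w by rewrite ler_pM2l.
      by rewrite ler_norml; apply/andP; split; lra.
  apply: (@le_trans _ _ (P (B Sf) + P (B Sr))%E); first by apply: measureU2; exact: mB.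
  apply: le_trans (leeD PBf PBr) _.
  by rewrite -EFinD lee_fin; lra.
have := probability_setC P mE; move: PC => + e; rewrite e.
have -> : P E = (fine (P E))%:E by rewrite fineK//; exact: fin_num_measure.
by rewrite -EFinB !lee_fin => ?; lra.
Qed.
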